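(* Let $\lambda, m, n$ be positive integers. Let $V(\lambda m K_n)=\mathbb{Z}_n$ and $V(\lambda K_{n\times m})=\bigcup_{i\in\mathbb{Z}_n}V_i$, where $V_0,V_1,\ldots,V_{n-1}$ are the parts of $\lambda K_{n\times m}$, each of size $m$. Suppose $\mathcal{D}=\{C_1,\ldots,C_k\}$ is a cycle decomposition of $\lambda m K_n$ (where, if $\lambda m(n-1)$ is odd, the decomposition additionally contains a single 1-factor besides the cycles $C_1,\ldots,C_k$). Then there exists a cycle decomposition $\mathcal{D}'=\{C_1',\ldots,C_k'\}$ of $\lambda K_{n\times m}$ (together with a single 1-factor if $\lambda m(n-1)$ is odd) such that $V(C_i')=\bigcup_{j\in V(C_i)}V_j$ for each $i\in\{1,\ldots,k\}$.
   Context: Graphs may have parallel edges. $\lambda K_n$ is the complete multigraph on $n$ vertices in which every pair of distinct vertices is joined by $\lambda$ parallel edges; $\lambda K_{n\times m}$ is the complete $\lambda$-fold $n$-partite multigraph with $n$ parts of size $m$ (two vertices in distinct parts are joined by $\lambda$ parallel edges, vertices in the same part are nonadjacent). A cycle decomposition of a graph $\mathcal{G}$ is a partition of its edge set into cycles (cycles of length 2, i.e. pairs of parallel edges, are allowed in multigraphs), or into cycles and a single 1-factor in case every vertex of $\mathcal{G}$ has odd degree. *)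

(* Defs.v *)
From mathcomp Require Import all_boot.

Set Implicit Arguments.
Unset Strict Implicit.
Unset Printing Implicit Defensive.

(* Finite loopless multigraphs: edges are objects of their own, so parallel
   edges are distinct elements of [edge] with the same [ends]. *)
Record multigraph := Multigraph {
  vertex : finType;
  edge : finType;
  ends : edge -> {set vertex};
  card_ends : forall e, #|ends e| = 2
}.

Section Multigraph.
Variable G : multigraph.
Implicit Types (C F : {set edge G}) (x : vertex G).

Definition degree x : nat := #|[set e : edge G | x \in ends e]|.

Definition vertices C : {set vertex G} := \bigcup_(e in C) ends e.

(* C is the edge set of a cycle v_0 e_0 v_1 e_1 ... v_(l-1) e_(l-1) v_0 with
   l >= 2, where e_i joins v_i to v_(i+1 mod l). The condition [uniq es] only
   matters for l = 2, where it says that e_0 and e_1 are two parallel edges. *)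
Definition is_cycle C : Prop :=
  exists (vs : seq (vertex G)) (es : seq (edge G)),
    [/\ 1 < size vs, uniq vs, uniq es,
        [seq ends e | e <- es] =
          [seq [set p.1; p.2] | p <- zip vs (rot 1 vs)]
      & C = [set e in es]].

Definition one_factor F : Prop :=
  forall x, #|[set e in F | x \in ends e]| = 1.

(* The cycles are listed as a family C; the edges they leave uncovered form
   the 1-factor when all degrees are odd, and there are none otherwise. *)
Definition cycle_decomposition k (C : 'I_k -> {set edge G}) : Prop :=
  let rest := ~: \bigcup_(i < k) C i in
  [/\ forall i, is_cycle (C i),
      forall i j, i != j -> [disjoint C i & C j]
    & if [forall x : vertex G, odd (degree x)] then one_factor rest
      else rest = set0].

End Multigraph.

Section Fold.
Variables (V : finType) (adj : rel V) (lambda : nat).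

Definition adjacent_pair (e : {set V}) : bool :=
  [exists x, exists y, [&& x != y, adj x y & e == [set x; y]]].

Lemma card_adjacent_pair (e : {e : {set V} | adjacent_pair e} * 'I_lambda) :
  #|val e.1| = 2.
Proof.
by case: e => -[e /= /existsP[x /existsP[y /and3P[xy _ /eqP->]]]] _; rewrite cards2 xy.
Qed.

(* The lambda-fold multiple of the simple graph on V with adjacency adj. *)
Definition fold_graph : multigraph := Multigraph card_adjacent_pair.

End Fold.

Definition complete_multigraph (lambda n : nat) : multigraph :=
  fold_graph (fun x y : 'I_n => x != y) lambda.

(* The vertex (i, a) is the a-th vertex of the i-th part. *)
Definition complete_multipartite (lambda n m : nat) : multigraph :=
  fold_graph (fun x y : 'I_n * 'I_m => x.1 != y.1) lambda.

Definition part (lambda n m : nat) (i : 'I_n) :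
    {set vertex (complete_multipartite lambda n m)} :=
  [set x : 'I_n * 'I_m | x.1 == i].

(* Main.v *)
Require Import Defs.
From mathcomp Require Import all_boot zify.

Set Implicit Arguments.
Unset Strict Implicit.
Unset Printing Implicit Defensive.

(* Amalgamation and detachment. Repeat every cycle [C_i] of the given
   decomposition [m] times and view each vertex [v] as the amalgamation of the
   [m] vertices of the part [V_v]: colour [i] becomes a closed trail passing [m]
   times through each of its vertices. Vertices are then split off one at a time.
   If [x] still represents [p >= 2] vertices, its passages cut the trail of each
   colour into [p] segments from [x] to [x]; a new vertex [y] takes over one end
   of two different segments, after which the segments can be reordered into a
   closed trail again. Hall's theorem selects the ends so that [y] receives
   exactly a proportion [1/p] of the edges between [x] and any other vertex. When
   every vertex represents only itself, the closed trails are cycles. *)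

(** * Selecting ends of segments *)

(** Hall's theorem with capacities, by induction on [#|A|]. If a nonempty proper subset of [A]
    attains equality in the condition, it and its complement are matched separately. Otherwise any
    single element can be matched at once to a neighbour with positive capacity. *)
Lemma hall_capacity (L R : finType) (N : L -> {set R}) (d : R -> nat) (r0 : R)
    (A : {set L}) :
    (forall S : {set L}, S \subset A ->
       #|S| <= \sum_(r in \bigcup_(a in S) N a) d r) ->
  exists f : L -> R, (forall a, a \in A -> f a \in N a) /\
    (forall r, #|[set a in A | f a == r]| <= d r).
Proof.
have [c] := ubnP #|A|; elim: c A d => // c IH A d ltAc hall.
have [->|[a aA]] := set_0Vmem A.
  exists (fun=> r0); split=> [a|r]; first by rewrite inE.
  by rewrite (_ : [set a in set0 | r0 == r] = set0) ?cards0 //; apply/setP=> a; rewrite !inE.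
pose nb (S : {set L}) := \bigcup_(a in S) N a.
pose tight (S : {set L}) :=
  [&& S \proper A, S != set0 & #|S| == \sum_(r in nb S) d r].
case: (pickP tight) => [S /and3P[SA S0 /eqP eqS]|slack].
  have sSA := proper_sub SA.
  have ltS : #|S| < #|A| := proper_card SA.
  have [|//|f [fN fd]] := IH S d; first by lia.
    by move=> S' sS'; apply: hall; apply: subset_trans sSA.
  have cardD : #|A :\: S| = #|A| - #|S| by rewrite cardsD (setIidPr sSA).
  have S_gt0 : 0 < #|S| by rewrite card_gt0.
  (* The tight set exhausts the capacity of [nb S], so nothing is left there for the complement.
     Hall's condition for [S'] outside [nb S] is the one for [S :|: S'] minus the equality for
     [S]. *)
  have [||g [gN gd]] := IH (A :\: S) (fun r => if r \in nb S then 0 else d r).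
  - by lia.
  - move=> S' sS'; have [sS'A disj] : S' \subset A /\ [disjoint S & S'].
      by move: sS'; rewrite subsetD disjoint_sym => /andP[-> ->].
    have := hall (S :|: S'); rewrite subUset sSA sS'A => /(_ isT).
    rewrite cardsU disjoint_setI0 // cards0 subn0 bigcup_setU eqS -/(nb S) -/(nb S').
    rewrite [X in _ <= X](big_setID (nb S)) /= setUK leq_add2l.
    move/leq_trans; apply; rewrite setDUl setDv set0U.
    rewrite [leqRHS](big_setID (nb S)) /= -[leqLHS]add0n leq_add //.
    by apply: leq_sum => r; rewrite inE => /andP[/negPf->].
  exists (fun a => if a \in S then f a else g a); split=> [b bA|r].
    by case: ifPn => bS; [exact: fN | apply: gN; rewrite inE bS].
  have [rS|rS] := boolP (r \in nb S).
    apply: leq_trans (fd r); apply: subset_leq_card; apply/subsetP=> b.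
    rewrite !inE => /andP[bA]; case: ifPn => // bS gb.
    have := gd r; rewrite rS leqn0 cards_eq0 => /eqP/setP/(_ b).
    by rewrite !inE bS bA gb.
  apply: leq_trans (leq_trans (gd r) _); last by rewrite (negPf rS).
  apply: subset_leq_card; apply/subsetP=> b; rewrite !inE => /andP[bA].
  case: ifPn => [bS /eqP fb|_ ->]; last by rewrite bA.
  by case/negP: rS; apply/bigcupP; exists b; rewrite // -fb fN.
have [r rN dr] : exists2 r, r \in N a & 0 < d r.
  have := hall [set a]; rewrite sub1set aA cards1 big_set1 => /(_ isT).
  by rewrite lt0n sum_nat_eq0 negb_forall_in => /exists_inP[r rN dr]; exists r; rewrite ?lt0n.
have [||f [fN fd]] := IH (A :\ a) (fun r' => d r' - (r' == r)).
- by rewrite (cardsD1 a A) aA in ltAc.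
- move=> S sS; have [->|S0] := eqVneq S set0; first by rewrite cards0.
  have pS : S \proper A.
    by apply: sub_proper_trans sS _; rewrite properD1.
  have := slack S; rewrite /tight pS S0 /= => /negbT ltS.
  (* As no proper nonempty subset is tight, the inequality is strict and survives the loss of one
     unit at [r]. *)
  have {ltS} : #|S| < \sum_(r in nb S) d r.
    by rewrite ltn_neqAle ltS hall // proper_sub.
  have [rS|rS] := boolP (r \in nb S); last first.
    move/ltnW/leq_trans; apply; apply: leq_sum => r' r'S.
    by case: eqP r'S rS => [->->|_]; rewrite ?subn0.
  rewrite (bigD1 r) //= => ltS; rewrite (bigD1 r) //= eqxx.
  rewrite (eq_bigr d); first by rewrite subn1; move: ltS dr; rewrite /nb; case: (d r) => // ? /=; rewrite addSn.
  by move=> r' /andP[_ /negPf->]; rewrite subn0.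
exists (fun b => if b == a then r else f b); split=> [b bA|r'].
  by case: eqVneq => [->//|ba]; rewrite fN // !inE ba.
have fdr := fd r'; rewrite [r' == _]eq_sym in fdr; rewrite (cardsD1 a) !inE aA eqxx /=.
rewrite (_ : [set _ in _ | _] :\ a = [set b in A :\ a | f b == r']).
  by case: eqP fdr dr => [->|_]; lia.
by apply/setP=> b; rewrite !inE; case: eqVneq => //=.
Qed.

(** Read [M] as a bipartite multigraph in which rows have degree [p] and a column has degree [p]
    times its capacity. Counting the edges that leave a set of rows gives Hall's condition. *)
Lemma regular_selection (L R : finType) (M : L -> R -> nat) (d : R -> nat) p :
    0 < p -> (forall a, \sum_r M a r = p) -> (forall r, \sum_a M a r = p * d r) ->
  exists f : L -> R, (forall a, 0 < M a (f a)) /\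
    (forall r, #|[set a | f a == r]| = d r).
Proof.
move=> p_gt0 rowM colM.
have [r0 _|noR] := pickP (mem R); last first.
  have noL (a : L) : False.
    by have := rowM a; rewrite big_pred0 //; lia.
  by exists (fun a => False_rect _ (noL a)); split=> [a|r]; [case: (noL a) | have := noR r].
have [S _|f [fN fd]] := @hall_capacity L R (fun a => [set r | 0 < M a r]) d r0 setT.
  rewrite -(leq_pmul2l p_gt0) big_distrr /=.
  under eq_bigr do rewrite -colM.
  rewrite exchange_big /= mulnC -sum_nat_const.
  rewrite [leqRHS](bigID (mem S)) /= -[leqLHS]addn0 leq_add //.
  apply: leq_sum => a aS; rewrite -(rowM a) (bigID (fun r => 0 < M a r)) /=.
  rewrite [X in _ + X]big1 ?addn0 => [|r]; last by rewrite -eqn0Ngt => /eqP.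
  rewrite [leqRHS](bigID (fun r => 0 < M a r)) /=.
  apply: leq_trans (leq_addr _ _); rewrite leq_eqVlt; apply/orP; left; apply/eqP.
  apply: eq_bigl => r; case: ltnP => Mar; rewrite ?andbF // andbT; apply/esym/bigcupP.
  by exists a; rewrite ?inE //.
exists f; split=> [a|]; first by have := fN a; rewrite !inE; apply.
(* Fibre sizes and capacities both add up to [#|L|], so no fibre can stay below its capacity. *)
have fd' r : #|[set a | f a == r]| <= d r ?= iff (#|[set a | f a == r]| == d r).
  apply: leqif_eq; apply: leq_trans (fd r).
  by apply: subset_leq_card; apply/subsetP=> a; rewrite !inE.
have /leqifP := leqif_sum (fun r (_ : true) => fd' r).
case: ifP => [/forall_inP eq_d _ r|_]; first exact/eqP/eq_d.
rewrite ltn_neqAle => /andP[/eqP[]].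
have -> : \sum_r #|[set a | f a == r]| = #|L|.
  rewrite -sum1_card (partition_big f predT) //=.
  by apply: eq_bigr => r _; rewrite -sum1dep_card.
apply/eqP; rewrite -(eqn_pmul2l p_gt0) [X in _ == X]big_distrr /=.
under [X in _ == X]eq_bigr do rewrite -colM.
rewrite exchange_big /=; under [X in _ == X]eq_bigr do rewrite rowM.
by rewrite sum_nat_const mulnC.
Qed.

Lemma sum_indicator (T : finType) (a : T) : \sum_z (a == z) = 1 :> nat.
Proof.
rewrite (bigD1 a) //= eqxx big1 // => z; rewrite eq_sym.
by move/negPf->.
Qed.

(* The unused segments of a colour [i] are matched with an extra column of
   capacity [p - 2], so that exactly two segments receive an element of [R]. *)
Lemma select_ends (K R : finType) (Q : eqType) (q0 : Q) (h l : Q -> R) (p : nat)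
    (u : pred K) (S : K -> seq Q) (b : bool) (B : R -> nat) (d : R -> nat) :
    1 < p -> (forall i, size (S i) = u i * p) -> \sum_r B r = b * p ->
    (forall r, \sum_i \sum_(q <- S i) ((h q == r) + (l q == r)) + B r = p * d r) ->
  exists (z : K -> R * R) (zb : R),
    [/\ forall i, u i -> exists q q' rest,
          [/\ perm_eq (S i) [:: q, q' & rest],
              (z i).1 \in [:: h q; l q] & (z i).2 \in [:: h q'; l q']],
        b -> 0 < B zb
      & forall r, \sum_(i | u i) (((z i).1 == r) + ((z i).2 == r)) + b * (zb == r) = d r].
Proof.
move=> p_gt1 sizeS sumB colS.
(* The rows are the [p] segments of each colour and one row for the 1-factor edges [B]. A colour
   with [u i] false sends all its [p] rows to its own extra column, and the last column absorbs the
   factor row when [b] is false. Thus every row sums to [p]. *)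
pose M (a : K * 'I_p + 'I_1) (r : R + (K + 'I_1)) : nat := match a, r with
  | inl (i, t), inl r => u i * ((h (nth q0 (S i) t) == r) + (l (nth q0 (S i) t) == r))
  | inl (i, t), inr (inl j) => if j == i then p - u i * 2 else 0
  | inr _, inl r => B r
  | inr _, inr (inr _) => ~~ b * p
  | _, _ => 0
  end.
pose D (r : R + (K + 'I_1)) : nat := match r with
  | inl r => d r | inr (inl j) => p - u j * 2 | inr (inr _) => ~~ b end.
have sumS i F : u i * (\sum_(t < p) F (nth q0 (S i) t)) = \sum_(q <- S i) F q.
  have := sizeS i; case: (u i) => /= [|/size0nil->]; last by rewrite big_nil.
  by rewrite !mul1n => szS; rewrite [RHS](big_nth q0) szS big_mkord.
have pairE (F : K * 'I_p -> nat) : \sum_a F a = \sum_i \sum_t F (i, t).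
  by rewrite pair_bigA; apply: eq_bigr => -[].
have rowM a : \sum_r M a r = p.
  rewrite !big_sumType /= big_ord1; case: a => [[i t]|o] /=.
    rewrite -big_distrr big_split /= !sum_indicator -big_mkcond big_pred1_eq.
    by case: (u i); lia.
  by rewrite sumB big1 // add0n -mulnDl; case: (b); rewrite !mul1n.
have colM r : \sum_a M a r = p * D r.
  rewrite big_sumType big_ord1 pairE /=.
  case: r => [r|[j|o]] /=.
  - rewrite -colS; congr (_ + _); apply: eq_bigr => i _.
    by rewrite -[RHS]sumS big_distrr.
  - rewrite addn0 (bigD1 j) //= [X in _ + X]big1 ?addn0 => [|i ij].
      by rewrite eqxx sum_nat_const card_ord.
    by rewrite big1 // => t _; rewrite eq_sym (negPf ij).
  - by rewrite mulnC big1 ?add0n // => i _; rewrite big1.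
have [f [fM fD]] := regular_selection (ltnW p_gt1) rowM colM.
pose r0 := h q0.
have pick_two i : exists z : R * R, (u i -> exists q q' rest,
      [/\ perm_eq (S i) [:: q, q' & rest],
          z.1 \in [:: h q; l q] & z.2 \in [:: h q'; l q']]) /\
    (forall r, \sum_(t < p) (f (inl (i, t)) == inl r) =
       u i * ((z.1 == r) + (z.2 == r))).
  have [ui|ui] := boolP (u i); last first.
    exists (r0, r0); split=> // r; rewrite big1 // => t _.
    by have := fM (inl (i, t)); rewrite /= (negPf ui); case: (f _).
  (* The extra column of colour [i] takes exactly [p - 2] segments, which leaves two. *)
  pose A := [set t : 'I_p | f (inl (i, t)) != inr (inl i)].
  have cardA : #|A| == 2.
    have := cardsC A; rewrite card_ord.
    suff -> : #|~: A| = p - 2 by lia.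
    have := fD (inr (inl i)); rewrite /= ui mul1n => <-.
    rewrite -(card_imset _ (_ : injective (fun t : 'I_p => inl 'I_1 (i, t)))); last first.
      by move=> t t' [].
    apply: eq_card => a; rewrite inE; apply/imsetP/idP => [[t]|].
      by rewrite !inE negbK => ? ->.
    have := fM a; case: a => [[j t]|o] /=; case Ef: (f _) => [?|[j'|?]] //=.
    case: eqP => // j'j _ /eqP[ij]; exists t; last by rewrite -ij j'j.
    by rewrite !inE -ij j'j Ef negbK -j'j.
  move: cardA => /cards2P[t [t' [tt' eqA]]].
  have inlA s : s \in A -> exists2 r, f (inl (i, s)) = inl r &
      r \in [:: h (nth q0 (S i) s); l (nth q0 (S i) s)].
    rewrite inE; have := fM (inl (i, s)); rewrite /= ui.
    case: (f _) => [r|[j|o]] //=; last by case: eqP => // ->; rewrite eqxx.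
    by move=> + _; rewrite mul1n addn_gt0 !lt0b => rQ; exists r; rewrite ?inE ?[r == _]eq_sym.
  have [|r fr rt] := inlA t; first by rewrite eqA !inE eqxx.
  have [|r' fr' rt'] := inlA t'; first by rewrite eqA !inE eqxx orbT.
  exists (r, r'); split=> [_|r1].
    exists (nth q0 (S i) t), (nth q0 (S i) t').
    exists [seq nth q0 (S i) s | s : 'I_p <- rem t' (rem t (enum 'I_p))].
    split=> //; have {1}-> : S i = [seq nth q0 (S i) s | s : 'I_p <- enum 'I_p].
      apply: (@eq_from_nth _ q0) => [|s]; first by rewrite size_map size_enum_ord sizeS ui mul1n.
      rewrite sizeS ui mul1n => sp; rewrite (nth_map (Ordinal sp)) ?size_enum_ord //.
      by rewrite nth_enum_ord.
    apply: (@perm_map _ _ _ _ [:: t, t' & rem t' (rem t (enum 'I_p))]).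
    apply: perm_trans (perm_to_rem (mem_enum _ t)) _.
    rewrite perm_cons; apply: perm_to_rem.
    by rewrite mem_rem_uniq ?enum_uniq // !inE eq_sym tt' mem_enum.
  rewrite mul1n (bigD1 t) //= (bigD1 t') /=; last by rewrite eq_sym.
  rewrite fr fr' big1 ?addn0 // => s.
  move=> /andP[st st']; have : s \notin A by rewrite eqA !inE negb_or st st'.
  by rewrite inE negbK => /eqP->.
have [z /all_and2[zS zr]] := fin_all_exists pick_two.
(* The default [r0] occurs only for [b] false, where [zb] is multiplied by zero. *)
exists z, (if f (inr ord0) is inl r then r else r0); split=> [//||r].
  move=> bT; have := fM (inr ord0) => /=; case: (f _) => [//|[?//|?]].
  by rewrite bT.
have := fD (inl r) => /= <-.
rewrite -sum1dep_card [RHS]big_mkcond big_sumType /= big_ord1; congr (_ + _).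
  rewrite [LHS]big_mkcond pairE; apply: eq_bigr => i _.
  transitivity (\sum_(t < p) (f (inl (i, t)) == inl r)).
    by rewrite zr; case: (u i); rewrite ?mul1n.
  by apply: eq_bigr => t _; case: eqP.
have := fM (inr ord0) => /=; case: (f _) => [r'|[?//|?]] /=; last by case: (b).
case: (b) sumB => [_ _|/eqP]; first by rewrite mul1n; case: eqP => [->|? ]; rewrite ?eqxx //; case: eqP => // -[].
by rewrite sum_nat_eq0 => /forall_inP/(_ r' isT)/eqP->.
Qed.

(** * Closed trails *)

Section Walks.
Variable X : finType.
Implicit Types (x y z : X) (s t : seq X) (e : {set X}).

(** Edges are recorded only by their pairs of ends, with multiplicity; they receive names in
    [realize]. This lets trails be cut, reversed and rearranged up to [perm_eq]. *)
Fixpoint walk x s y : seq {set X} :=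
  if s is z :: s' then [set x; z] :: walk z s' y else [:: [set x; y]].

Definition closed_walk s : seq {set X} := if s is x :: s' then walk x s' x else [::].

Lemma walk_cat x s z t y : walk x (s ++ z :: t) y = walk x s z ++ walk z t y.
Proof. by elim: s x => //= c s IH x; rewrite IH. Qed.

Lemma walk_rev x s y : perm_eq (walk x (rev s) y) (walk y s x).
Proof.
elim: s y => [|z s IH] y /=; first by rewrite setUC.
by rewrite rev_cons -cats1 walk_cat /= setUC perm_catC /= perm_cons IH.
Qed.

Lemma closed_walk_rot s t : perm_eq (closed_walk (s ++ t)) (closed_walk (t ++ s)).
Proof.
case: s t => [|x s] [|y t] /=; rewrite ?cats0 //.
by rewrite !walk_cat perm_catC.
Qed.

Lemma closed_walk_zip s :
  closed_walk s = [seq [set q.1; q.2] | q <- zip s (rot 1 s)].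
Proof.
case: s => //= x s; rewrite rot1_cons; move: {2 4}x => y.
by elim: s x => //= z s IH x; rewrite IH.
Qed.

Lemma walk_flatten x a t (S : seq (seq X)) :
  walk a (t ++ flatten [seq x :: s | s <- S]) x
    = walk a t x ++ flatten [seq walk x s x | s <- S].
Proof.
elim: S a t => [|s S IH] a t /=; first by rewrite !cats0.
by rewrite walk_cat IH.
Qed.

(** Rotate the closed trail to start at [x] and cut it before each occurrence of [x]. *)
Lemma split_at x s : x \in s ->
  exists S : seq (seq X),
    [/\ perm_eq s (flatten [seq x :: t | t <- S]),
        perm_eq (closed_walk s) (flatten [seq walk x t x | t <- S])
      & forall t, t \in S -> x \notin t].
Proof.
move=> /splitPr[s1 s2].
have [t [S [eS xt xS]]] : exists t (S : seq (seq X)),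
    [/\ s2 ++ s1 = t ++ flatten [seq x :: t | t <- S], x \notin t
      & forall t, t \in S -> x \notin t].
  elim: (s2 ++ s1) => [|y s3 [t [S [-> xt xS]]]]; first by exists [::], [::].
  have [<-|xy] := eqVneq x y; last by exists (y :: t), S; rewrite inE negb_or xy.
  by exists [::], (t :: S); split=> // t'; rewrite inE => /predU1P[->//|/xS].
exists (t :: S); split.
- by rewrite perm_catC /= eS.
- by apply: perm_trans (closed_walk_rot _ _) _; rewrite /= eS walk_flatten.
- by move=> t'; rewrite inE => /predU1P[->//|/xS].
Qed.

(** A segment from [x] to [x] may be traversed backwards, so either of its ends can come first. *)
Lemma orient x s z : s != [::] -> z \in [:: head x s; last x s] ->
  exists t, perm_eq s (z :: t) /\ perm_eq (walk x s x) (walk x (z :: t) x).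
Proof.
move=> s0; rewrite !inE => /orP[] /eqP->.
  by case: s s0 => // y s _; exists s.
case/lastP: s s0 => // s y _; rewrite last_rcons; exists (rev s).
rewrite -rev_rcons perm_sym perm_rev; split=> //.
by rewrite perm_sym walk_rev.
Qed.

(* The two freed ends [z] and [z'] belong to different returns to [x], so the
   remaining returns can be inserted between them. *)
Lemma reroute x y S s s' rest z z' :
    perm_eq S [:: s, s' & rest] -> s != [::] -> s' != [::] ->
    z \in [:: head x s; last x s] -> z' \in [:: head x s'; last x s'] ->
  exists T : seq X,
    (forall v, count_mem v T + (x == v) =
       count_mem v (flatten [seq x :: t | t <- S]) + (y == v)) /\
    (forall e, count_mem e (closed_walk T) + (([set x; z] == e) + ([set x; z'] == e)) =
       count_mem e (flatten [seq walk x t x | t <- S])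
         + (([set y; z] == e) + ([set y; z'] == e))).
Proof.
move=> pS s0 s'0 zs z's'.
have [t [pt wt]] := orient s0 zs; have [t' [pt' wt']] := orient s'0 z's'.
(* Leave [y] along the first segment, return to [x], traverse the remaining segments, then follow
   the second segment backwards so that it ends at [z'] and closes at [y]. *)
exists (y :: (z :: t) ++ flatten [seq x :: r | r <- rest] ++ x :: rev (z' :: t')).
have flatS (A : eqType) (F : seq X -> seq A) :
    perm_eq (flatten (map F S)) (F s ++ F s' ++ flatten (map F rest)).
  by apply: (perm_flatten (perm_map F pS)).
split=> [v|e].
  rewrite (permP (flatS _ _)) /= !count_cat /= !count_cat /= count_rev.
  by rewrite (permP pt) (permP pt') /=; lia.
rewrite (permP (flatS _ _)) /= !count_cat (permP wt) (permP wt').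
rewrite catA walk_cat walk_flatten !count_cat (permP (walk_rev _ _ _)) /=.
by lia.
Qed.

End Walks.

Section Pairs.
Variable X : finType.
Implicit Types (x y z : X) (s t : seq X) (e : {set X}).

Lemma eq_set2l x y z : ([set x; y] == [set x; z]) = (y == z).
Proof.
apply/eqP/eqP => [/setP eq_xyz|->//].
have := eq_xyz y; have := eq_xyz z; rewrite !inE !eqxx !orbT.
by case: eqVneq => [->|_]; case: eqVneq => [->|_] //=; rewrite ?eqxx // => /eqP.
Qed.

Lemma sum_set2 x e : #|e| = 2 -> \sum_z (e == [set x; z]) = (x \in e).
Proof.
move=> /eqP/cards2P[a [b [ab ->]]].
have [xab|xab] := boolP (x \in [set a; b]); last first.
  rewrite big1 // => z _; case: eqP xab => // ->.
  by rewrite !inE eqxx.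
have [c ->] : exists c, [set a; b] = [set x; c].
  by move: xab; rewrite !inE => /orP[] /eqP->; [exists b | exists a; rewrite setUC].
by under eq_bigr do rewrite eq_set2l; rewrite sum_indicator.
Qed.

Lemma count_set2 x (F : seq {set X}) : (forall e, e \in F -> #|e| = 2) ->
  count (fun e : {set X} => x \in e) F = \sum_z count_mem [set x; z] F.
Proof.
elim: F => [|e F IH] card2 /=; first by rewrite big1.
rewrite big_split /= -IH => [|e' e'F]; last by rewrite card2 // inE e'F orbT.
by rewrite sum_set2 // card2 // mem_head.
Qed.

Lemma mem_walk x a s b e : e \in walk a s b -> x \in e -> x \in a :: rcons s b.
Proof.
elim: s a => [|c s IH] a /=; rewrite in_cons => /predU1P[->|]; rewrite ?in_nil //.
- by rewrite !inE.
- by rewrite !inE => /orP[]->; rewrite ?orbT.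
by move=> /IH/[apply] xs; rewrite in_cons xs orbT.
Qed.

Lemma mem_closed_walk x s e : e \in closed_walk s -> x \in e -> x \in s.
Proof.
case: s => //= a s /mem_walk/[apply].
by rewrite !(in_cons, mem_rcons); case: (x == a).
Qed.

Lemma count_walk x a r s : x != a -> x \notin s ->
  count_mem [set x; r] (walk a s x) = (last a s == r).
Proof.
elim: s a => [|c s IH] a xa /=; first by rewrite setUC eq_set2l addn0.
rewrite inE negb_or => /andP[xc xs]; rewrite IH //.
case: eqP => // /setP/(_ x); rewrite !inE eqxx.
by rewrite (negPf xa) (negPf xc).
Qed.

(** Only the first and the last edge of a segment meet [x]. A segment with a single vertex counts
    twice, its two edges being parallel. *)
Lemma count_loop x r s : s != [::] -> x \notin s ->
  count_mem [set x; r] (walk x s x) = (head x s == r) + (last x s == r).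
Proof.
case: s => //= a s _; rewrite inE negb_or => /andP[xa xs].
by rewrite count_walk // eq_set2l.
Qed.

(** When [d r] edges to each [r] move from one vertex to another, this gives the loss of the pair of
    [a] and [b] (for the old vertex) and its gain (for the new one). *)
Lemma sum_count_set2 (d : X -> nat) x a b :
  \sum_r d r * ([set x; r] == [set a; b]) =
    if x == a then d b else if x == b then d a else 0.
Proof.
have single c f : \sum_r d r * (r == c) * f = d c * f :> nat.
  by rewrite (bigD1 c) //= eqxx muln1 big1 ?addn0 // => r /negPf->; rewrite muln0.
case: eqVneq => [->|xa].
  rewrite -[RHS]muln1 -single; apply: eq_bigr => r _.
  by rewrite eq_set2l muln1.
case: eqVneq => [->|xb].
  rewrite -[RHS]muln1 -single; apply: eq_bigr => r _.
  by rewrite [[set a; b]]setUC eq_set2l muln1.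
rewrite big1 // => r _; case: eqP => [/setP/(_ x)|]; rewrite ?muln0 //.
by rewrite !inE eqxx (negPf xa) (negPf xb).
Qed.

End Pairs.

(** * Splitting off the vertices of the parts *)

Section Detachment.
Variables (X K : finType) (V : finType) (pi : X -> V) (U : K -> {set V}).
Variables (lam : nat) (b : bool).

(* The vertex [x] stands for [w x] vertices of its part that have not been
   separated yet: [T i] is the closed trail of colour [i], passing [w x] times
   through [x], and [F] lists the edges of the 1-factor. *)
Record detached (w : X -> nat) (T : K -> seq X) (F : seq {set X}) : Prop := Detached {
  trail_count : forall i x, count_mem x (T i) = (pi x \in U i) * w x;
  factor_card : forall e, e \in F -> #|e| = 2;
  factor_count : forall x, count (fun e : {set X} => x \in e) F = b * w x;
  pair_count : forall x y,
    \sum_i count_mem [set x; y] (closed_walk (T i)) + count_mem [set x; y] F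
      = lam * ((pi x != pi y) * (w x * w y)) }.

(** No segment is empty, since [pair_count] at [x] and [x] excludes loops. A colour that misses the
    part of [x] gets the empty list, so that one count formula covers all colours. *)
Lemma segments w T F x i : detached w T F -> 0 < w x ->
  exists S : seq (seq X),
    [/\ size S = (pi x \in U i) * w x,
        forall t, t \in S -> t != [::] /\ x \notin t,
        pi x \in U i -> perm_eq (T i) (flatten [seq x :: t | t <- S]),
        pi x \in U i ->
          perm_eq (closed_walk (T i)) (flatten [seq walk x t x | t <- S])
      & forall r, count_mem [set x; r] (closed_walk (T i)) =
          \sum_(t <- S) ((head x t == r) + (last x t == r))].
Proof.
move=> D w_gt0; have := trail_count D i x; case: (boolP (_ \in _)) => xU.
  rewrite mul1n => cx; have xT : x \in T i by rewrite -has_pred1 has_count cx.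
  have [S [pT pW xS]] := split_at xT.
  have S0 t : t \in S -> t != [::].
    apply: contraTneq => ->; apply/negP => S0.
    have := pair_count D x x; rewrite eqxx mul0n muln0 => /eqP.
    rewrite addn_eq0 sum_nat_eq0 => /andP[/forall_inP/(_ i isT)/eqP+ _].
    apply/eqP; rewrite -lt0n -has_count has_pred1 (perm_mem pW).
    apply/flattenP; exists (walk x [::] x); last by rewrite /= mem_head.
    by apply/mapP; exists [::].
  exists S; split=> // [|t tS|r]; last 2 first.
  - by split; [exact: S0 | exact: xS].
  - rewrite (permP pW) count_flatten -map_comp sumnE big_map !big_seq.
    by apply: eq_bigr => t tS; rewrite /= count_loop ?S0 ?xS.
  rewrite -cx (permP pT); elim: (S) xS => //= t S' IH xS'.
  rewrite eqxx count_cat (count_memPn _) ?xS' ?mem_head // IH // => t' t'S'.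
  by rewrite xS' // inE t'S' orbT.
rewrite mul0n => cx; exists [::]; split=> // r; rewrite big_nil.
apply/count_memPn/negP => /mem_closed_walk/(_ (set21 _ _)).
by rewrite -has_pred1 has_count cx.
Qed.

(** For every [r], the new vertex [y] takes over [d r] edges, one [w x]-th of those between [x] and
    [r]. They consist of two edges from each trail through the part and, if [b] holds, one factor
    edge. *)
Lemma detach w T F x y : detached w T F ->
    pi x = pi y -> x != y -> 1 < w x -> w y = 0 ->
  exists T' F', detached (fun v => w v + (y == v) - (x == v)) T' F'.
Proof.
move=> D pixy xy w_gt1 wy0; have w_gt0 := ltnW w_gt1.
have [S /all_and5[sizeS segS pT pW countS]] := fin_all_exists (fun i => segments i D w_gt0).
pose u i := pi x \in U i; pose d r := lam * ((pi x != pi r) * w r).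
have [||z [zb [zS zF zd]]] := @select_ends K X (seq X) [::] (head x) (last x) (w x)
    u S b (fun r => count_mem [set x; r] F) d w_gt1 sizeS.
- by rewrite -count_set2 ?(factor_count D) //; exact: factor_card D.
- move=> r; under eq_bigr do rewrite -countS.
  by rewrite (pair_count D) /d; lia.
(* The selected factor edge is counted in [d zb], which vanishes inside the part of [x]. *)
have zb_pi : b -> pi x != pi zb.
  move=> bT; have := zd zb; rewrite bT eqxx /d; case: (pi x != _) => //.
  by rewrite muln0 addn1.
have zdf (f : X -> nat) :
    \sum_(i | u i) (f (z i).1 + f (z i).2) + b * f zb = \sum_r d r * f r.
  have single a : \sum_r (a == r) * f r = f a.
    rewrite (bigD1 a) //= eqxx mul1n big1 ?addn0 // => r.
    by rewrite eq_sym => /negPf->.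
  under [RHS]eq_bigr do rewrite -zd mulnDl big_distrl /= -mulnA.
  rewrite [RHS]big_split /= exchange_big /= -big_distrr /= single; congr (_ + _).
  apply: eq_bigr => i _; under eq_bigr do rewrite mulnDl.
  by rewrite big_split /= !single.
(* The changes are added on both sides to avoid truncated subtraction; the factor [u i] leaves the
   trails that miss the part unchanged. *)
have rerouted i : exists R : seq X,
    (forall v, count_mem v R + u i * (x == v) = count_mem v (T i) + u i * (y == v)) /\
    (forall e, count_mem e (closed_walk R)
         + u i * (([set x; (z i).1] == e) + ([set x; (z i).2] == e)) =
       count_mem e (closed_walk (T i))
         + u i * (([set y; (z i).1] == e) + ([set y; (z i).2] == e))).
  case ui: (u i); last by exists (T i).
  have [q [q' [rest [pS zq zq']]]] := zS i ui.
  have inS t : t \in [:: q, q' & rest] -> t != [::].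
    by rewrite -(perm_mem pS) => /segS[].
  have [||R [Rv Re]] := reroute y pS _ _ zq zq'; try by apply: inS; rewrite !inE eqxx ?orbT.
  exists R; split=> [v|e]; first by rewrite (permP (pT i ui)) !mul1n.
  by rewrite (permP (pW i ui)) !mul1n.
have [T' /all_and2[T'v T'e]] := fin_all_exists rerouted.
have [F' [F'2 F'v F'e]] : exists F' : seq {set X}, [/\ forall e, e \in F' -> #|e| = 2,
    forall v, count (fun e : {set X} => v \in e) F' + b * (x == v) =
      count (fun e : {set X} => v \in e) F + b * (y == v)
    & forall e, count_mem e F' + b * ([set x; zb] == e) =
        count_mem e F + b * ([set y; zb] == e)].
  have := factor_card D; case: (b) zF zb_pi => [/(_ isT) zF /(_ isT) pizb|_ _] F2; last by exists F.
  have pF : perm_eq F ([set x; zb] :: rem [set x; zb] F).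
    by apply: perm_to_rem; rewrite -has_pred1 has_count.
  have xzb : x != zb by apply: contraNneq pizb => ->.
  have yzb : y != zb by apply: contraNneq pizb => <-; rewrite pixy.
  exists ([set y; zb] :: rem [set x; zb] F); split=> [e|v|e].
  - by rewrite inE => /predU1P[->|/mem_rem/F2//]; rewrite cards2 yzb.
  - rewrite (permP pF) /= !inE.
    have [->|vx] := eqVneq v x; first by rewrite [y == x]eq_sym (negPf xy) (negPf xzb); lia.
    have [->|vy] := eqVneq v y; first by rewrite (negPf yzb); lia.
    by lia.
  - by rewrite (permP pF) /=; lia.
exists T', F'; split=> //.
- move=> i v; have := T'v i v; rewrite (trail_count D) /u.
  have [->|_] := eqVneq x v; first by rewrite -[y == v]/(y == v); case: (_ \in _); lia.
  have [<-|_] := eqVneq y v; first by rewrite pixy; case: (_ \in _); lia.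
  by case: (_ \in _); lia.
- move=> v; have := F'v v; rewrite (factor_count D); case: (b); last by lia.
  by lia.
move=> a c; pose e : {set X} := [set a; c].
have := pair_count D a c; rewrite -/e.
(* By [zdf] the selected ends, over all colours and the factor, amount to [d r] for each [r]: this
   many edges pass from the pair of [x] and [r] to the pair of [y] and [r]. *)
have : \sum_i count_mem e (closed_walk (T' i)) + count_mem e F'
    + \sum_r d r * ([set x; r] == e) =
    \sum_i count_mem e (closed_walk (T i)) + count_mem e F
    + \sum_r d r * ([set y; r] == e).
  rewrite -!zdf ![\sum_(i | u i) _]big_mkcond.
  have mulif i n : (if u i then n else 0) = u i * n by case: (u i); rewrite ?mul1n.
  under [X in _ + _ + (X + _) = _]eq_bigr do rewrite mulif.
  under [X in _ = _ + _ + (X + _)]eq_bigr do rewrite mulif.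
  rewrite addnACA -big_split /= F'e; under eq_bigr do rewrite T'e.
  by rewrite big_split /= addnACA.
rewrite !sum_count_set2 => E PC; move: E; rewrite {}PC -/e.
set N := _ + count_mem e F'; rewrite /d.
(* Towards another part, [x] keeps [w x - 1] of its [w x] shares and [y] gets one share, having had
   none. Inside the part [d] is zero, and pairs avoiding both vertices do not change. *)
have [<-|xa] := eqVneq x a.
  rewrite [y == x]eq_sym (negPf xy).
  have [<-|xc] := eqVneq x c; first by rewrite eqxx /= !(mul0n, muln0) ?if_same; lia.
  have [<-|yc] := eqVneq y c; first by rewrite -pixy eqxx /= !(mul0n, muln0) ?if_same; lia.
  by case: (pi x == pi c) => /=; nia.
have [<-|ya] := eqVneq y a.
  rewrite -pixy; have [<-|xc] := eqVneq x c; first by rewrite eqxx /= !(mul0n, muln0) ?if_same; lia.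
  have [<-|yc] := eqVneq y c; first by rewrite -pixy eqxx /= !(mul0n, muln0) ?if_same; lia.
  by rewrite wy0; case: (pi x == pi c) => /=; nia.
have [<-|xc] := eqVneq x c.
  rewrite [y == x]eq_sym (negPf xy) -?pixy [pi a == _]eq_sym.
  by case: (pi x == pi a) => /=; nia.
have [<-|yc] := eqVneq y c; last by nia.
by rewrite -pixy [pi a == _]eq_sym wy0; case: (pi x == pi a) => /=; nia.
Qed.

End Detachment.

Section DetachAll.
Variables (X K : finType) (V : finType) (pi : X -> V) (U : K -> {set V}).
Variables (lam : nat) (b : bool).

(** Induction on the number of vertices of weight zero. The weights of a part add up to its size, so
    a zero forces a weight above one in the same part, which [detach] can split; without zeros all
    weights are one. *)
Lemma detach_all w T F : detached pi U lam b w T F ->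
    (forall v, \sum_(x | pi x == v) w x = \sum_(x | pi x == v) 1) ->
  exists T' F', detached pi U lam b (fun=> 1) T' F'.
Proof.
have [c] := ubnP #|[set x | w x == 0]|; elim: c w T F => // c IH w T F ltc D sumw.
have [y wy0|w_gt0] := pickP (fun y => w y == 0); last first.
  have w1 x : w x = 1.
    have := sumw (pi x); rewrite (bigD1 x) //= [RHS](bigD1 x) //=.
    have : \sum_(y | (pi y == pi x) && (y != x)) 1 <= \sum_(y | (pi y == pi x) && (y != x)) w y.
      by apply: leq_sum => y _; rewrite lt0n w_gt0.
    by have := w_gt0 x; lia.
  exists T, F; case: D => cT F2 cF cP.
  by split=> // *; rewrite ?cT ?cF ?cP ?w1.
have [x /andP[/eqP pixy wx]|w_le1] := pickP (fun x => (pi x == pi y) && (1 < w x)); last first.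
  have := sumw (pi y); rewrite (bigD1 y) //= [RHS](bigD1 y) //= (eqP wy0).
  have : \sum_(x | (pi x == pi y) && (x != y)) w x <= \sum_(x | (pi x == pi y) && (x != y)) 1.
    by apply: leq_sum => x /andP[xy _]; have := w_le1 x; rewrite xy; lia.
  by lia.
have xy : x != y by apply: contraTneq wx => ->; rewrite (eqP wy0).
have [T' [F' D']] := detach D pixy xy wx (eqP wy0).
apply: (IH _ T' F' _ D') => [|v].
  apply: leq_trans (_ : #|[set z | w z == 0]| <= c); last by lia.
  apply: proper_card; apply/properP; split; last first.
    by exists y; rewrite !inE ?wy0 // eqxx (negPf xy); lia.
  apply/subsetP=> z; rewrite !inE; have [<-|_] := eqVneq x z; last by lia.
  by lia.
rewrite -sumw; have one z : \sum_(u | pi u == v) (z == u) = (pi z == v).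
  have [zv|zv] := boolP (pi z == v).
    rewrite (bigD1 z) //= eqxx big1 // => u /andP[_]; rewrite eq_sym.
    by move/negPf->.
  by rewrite big1 // => u uv; apply/eqP; rewrite eqb0; apply: contraNneq zv => ->.
apply/eqP; rewrite -(eqn_add2r (pi x == v)) {2}pixy -!one -!big_split /=.
by apply/eqP/eq_bigr => u _; have [<-|_] := eqVneq x u; lia.
Qed.

End DetachAll.

(** * Matching and counting edges by their ends *)

Lemma fiber_bij (P E A : finType) (h : P -> A) (f : E -> A) :
    (forall a, #|[set p | h p == a]| = #|[set e | f e == a]|) ->
  exists2 g : P -> E, bijective g & forall p, f (g p) = h p.
Proof.
move=> fibers; have cardPE : #|P| = #|E|.
  rewrite -[LHS]sum1_card -[RHS]sum1_card (partition_big h predT) //=.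
  rewrite [RHS](partition_big f predT) //=.
  by apply: eq_bigr => a _; rewrite !sum1dep_card fibers.
pose hs a := enum [set p | h p == a]; pose fs a := enum [set e | f e == a].
have sizes a : size (hs a) = size (fs a) by rewrite -!cardE fibers.
have idx p : index p (hs (h p)) < size (fs (h p)).
  by rewrite -sizes index_mem mem_enum inE.
have [e0 _|noE] := pickP (mem E); last first.
  have noP (p : P) : False.
    by have := idx p; rewrite -cardE eq_card0 // => e; have := noE e.
  have g0 (p : P) : E := False_rect _ (noP p).
  exists g0; last by move=> p; case: (noP p).
  by apply: inj_card_bij; [move=> p; case: (noP p) | rewrite cardPE].
(* Elements over the same value correspond by their positions in the enumerations of the two
   fibres. *)
pose g p := nth e0 (fs (h p)) (index p (hs (h p))).
have fg p : f (g p) = h p.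
  by have := mem_nth e0 (idx p); rewrite mem_enum inE => /eqP.
exists g => //; apply: inj_card_bij; last by rewrite cardPE.
move=> p q gpq; have hpq : h p = h q by rewrite -!fg gpq.
move/eqP: gpq; rewrite /g hpq nth_uniq ?enum_uniq // -?{1}hpq ?idx // => /eqP.
by apply: (index_inj p); rewrite mem_enum inE ?hpq.
Qed.

Section FoldGraph.
Variables (V : finType) (adj : rel V) (lam : nat).
Hypotheses (adj_sym : symmetric adj) (adj_irr : irreflexive adj).
Let G := fold_graph adj lam.

Lemma adjacent_pair_set2 x y : adjacent_pair adj [set x; y] = adj x y.
Proof.
apply/idP/idP => [/existsP[a /existsP[c /and3P[_ ac /eqP eqs]]]|xy].
  have : x \in [set a; c] by rewrite -eqs set21.
  rewrite !inE => /orP[] /eqP xE; move/eqP: eqs; rewrite xE.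
    by rewrite eq_set2l => /eqP->.
  by rewrite [[set a; c]]setUC eq_set2l adj_sym => /eqP->.
apply/existsP; exists x; apply/existsP; exists y; rewrite xy eqxx !andbT.
by apply: contraTneq xy => ->; rewrite adj_irr.
Qed.

Lemma card_fold_ends (A : {set V}) :
  #|[set e : edge G | ends e == A]| = adjacent_pair adj A * lam.
Proof.
have [adjA|nadjA] := boolP (adjacent_pair adj A).
  pose eA : {e | adjacent_pair adj e} := exist _ A adjA.
  rewrite mul1n; transitivity #|setX [set eA] [set: 'I_lam]|; last first.
    by rewrite cardsX cards1 cardsT card_ord mul1n.
  by apply: eq_card => -[e c]; rewrite !inE -val_eqE /= andbT.
rewrite mul0n; apply/eqP; rewrite cards_eq0 -subset0; apply/subsetP => -[[e adje] c].
by rewrite !inE => /eqP eA; rewrite -eA adje in nadjA.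
Qed.

Lemma degree_fold (x : vertex G) : degree x = (\sum_y adj x y) * lam.
Proof.
rewrite /degree -sum1dep_card big_mkcond /=.
transitivity (\sum_(e : edge G) \sum_(y : vertex G) (ends e == [set x; y])).
  by apply: eq_bigr => e _; rewrite sum_set2 ?card_ends //; case: (_ \in _).
rewrite exchange_big big_distrl; apply: eq_bigr => y _ /=.
rewrite -adjacent_pair_set2 -card_fold_ends -sum1dep_card [RHS]big_mkcond.
by apply: eq_bigr => e _; case: eqP.
Qed.

End FoldGraph.

(** * Amalgamating and labelling the edges *)

Lemma walk_pair (X : finType) x s y (e : {set X}) :
  e \in walk x s y -> exists a b, e = [set a; b].
Proof.
elim: s x => [|z s IH] x /=; rewrite inE; first by move/eqP->; exists x, y.
by case/predU1P => [->|/IH//]; exists x, z.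
Qed.

Lemma closed_walk_cover (X : finType) x (s : seq X) :
  x \in s -> exists2 e, e \in closed_walk s & x \in e.
Proof.
move=> /splitPr[s1 s2].
suff: exists2 e, e \in closed_walk ((x :: s2) ++ s1) & x \in e.
  by case=> e eW xe; exists e => //; rewrite (perm_mem (closed_walk_rot _ _)).
by rewrite /=; case: (s2 ++ s1) => [|y s3] /=; [exists [set x; x] | exists [set x; y]];
  rewrite ?inE ?eqxx.
Qed.

Lemma closed_walk_nseq (X : finType) m (s : seq X) :
  closed_walk (flatten (nseq m s)) = flatten (nseq m (closed_walk s)).
Proof.
case: s => [|x s]; first by elim: m.
elim: m => // -[_|m IH] /=; first by rewrite !cats0.
by rewrite walk_cat; congr (_ ++ _); exact: IH.
Qed.

Lemma closed_walk_map (X Y : finType) (f : X -> Y) s :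
  closed_walk (map f s) = [seq f @: (e : {set X}) | e <- closed_walk s].
Proof.
case: s => //= x s; move: {2 4}x => y.
by elim: s x => [|z s IH] x /=; rewrite ?IH imsetU1 imset_set1.
Qed.

Lemma count_flatten_nseq (T : Type) (a : pred T) m s :
  count a (flatten (nseq m s)) = m * count a s.
Proof. by elim: m => //= m IH; rewrite count_cat IH. Qed.

Lemma count_enum (T : finType) (A : {set T}) (P : pred T) :
  count P (enum A) = #|[set x in A | P x]|.
Proof. by rewrite -sum1_count big_enum_cond /= sum1dep_card. Qed.

Lemma count_uniq (T : finType) (s : seq T) (P : pred T) :
  uniq s -> count P s = #|[set x in [set y in s] | P x]|.
Proof.
move=> s_uniq; rewrite -count_enum; apply/permP/uniq_perm; rewrite ?enum_uniq //.
by move=> x; rewrite mem_enum inE.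
Qed.

Section Cycles.
Variable G : multigraph.

Lemma is_cycle_walk (C : {set edge G}) : is_cycle C <->
  exists vs es, [/\ 1 < size vs, uniq vs, uniq es,
    [seq ends e | e <- es] = closed_walk vs & C = [set e in es]].
Proof.
split=> -[vs [es [? ? ? E ?]]]; exists vs, es; split=> //.
  by rewrite closed_walk_zip.
by rewrite E closed_walk_zip.
Qed.

Lemma vertices_walk (vs : seq (vertex G)) (es : seq (edge G)) :
  [seq ends e | e <- es] = closed_walk vs ->
  vertices [set e in es] = [set x in vs].
Proof.
move=> E; apply/setP=> x; rewrite !inE; apply/bigcupP/idP => [[e ees xe]|xvs].
  apply: (mem_closed_walk _ xe); rewrite -E map_f //.
  by rewrite inE in ees.
have [A] := closed_walk_cover xvs; rewrite -E => /mapP[e ees ->] xe.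
by exists e; rewrite ?inE.
Qed.

Lemma sum_blocks k (C : 'I_k -> {set edge G}) (P : pred (edge G)) :
    (forall i j, i != j -> [disjoint C i & C j]) ->
  \sum_i #|[set e in C i | P e]| + #|[set e in ~: \bigcup_(i < k) C i | P e]|
    = #|[set e | P e]|.
Proof.
move=> disjC; have card_sum (A : {set edge G}) :
    #|[set e in A | P e]| = \sum_(e | P e) (e \in A).
  rewrite -sum1dep_card big_mkcondl; apply: eq_bigr => e _.
  by case: (e \in A).
rewrite card_sum; under eq_bigr do rewrite card_sum.
rewrite exchange_big -big_split -sum1dep_card; apply: eq_bigr => e _ /=.
rewrite inE; case: bigcupP => [[i _ ei]|none].
  rewrite (bigD1 i) //= ei big1 // => j ji; apply/eqP; rewrite eqb0.
  by have := disjC _ _ ji; rewrite disjoint_sym => /disjointFr->.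
by rewrite big1 // => i _; apply/eqP; rewrite eqb0; apply/negP => ei; case: none; exists i.
Qed.

(** The amalgam that starts the detachment: [(v, o)] carries the whole weight [m] of the part of
    [v], and the other vertices carry none. Repeating cycles and factor [m] times turns the
    [lam * m] edges of a pair into [lam * (m * m)], as [pair_count] requires. *)
Lemma detached_blowup k (C : 'I_k -> {set edge G}) lam m (o : 'I_m) :
    cycle_decomposition C ->
    (forall u v : vertex G, #|[set e : edge G | ends e == [set u; v]]| = (u != v) * (lam * m)) ->
  exists T F, detached (fun x : vertex G * 'I_m => x.1) (fun i => vertices (C i))
    lam [forall x : vertex G, odd (degree x)] (fun x => (x.2 == o) * m) T F.
Proof.
move=> [cycC disjC restC] pairG; set b := [forall x, _] in restC *; set rest := ~: _ in restC.
have dataC i : exists ve : seq (vertex G) * seq (edge G),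
    [/\ uniq ve.1, uniq ve.2, [seq ends e | e <- ve.2] = closed_walk ve.1
      & C i = [set e in ve.2]].
  by have /is_cycle_walk[vs [es [_ ? ? ? ?]]] := cycC i; exists (vs, es).
have [ve /all_and4[uniqv uniqe endsC defC]] := fin_all_exists dataC.
pose j (v : vertex G) := (v, o); have j_inj : injective j by move=> u v [].
have mem_j (A : {set vertex G}) x : (x \in j @: A) = (x.2 == o) && (x.1 \in A).
  apply/imsetP/andP => [[v vA ->]|[/eqP xo xA]]; first by rewrite eqxx vA.
  by exists x.1 => //; rewrite /j -xo; case: x {xo xA}.
exists (fun i => flatten (nseq m (map j (ve i).1))).
exists (flatten (nseq m [seq j @: (ends e) | e <- enum rest])).
split=> [i x|e|x|x y].
- rewrite count_flatten_nseq defC (vertices_walk (endsC i)) inE count_map.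
  rewrite (eq_count (a2 := fun v => (x.2 == o) && (v == x.1))); last first.
    by move=> v /=; rewrite /j; case: x => x1 x2; rewrite -pair_eqE /= andbC eq_sym.
  case: (x.2 == o) => /=; last by rewrite count_pred0; lia.
  by rewrite -/(count_mem _ _) count_uniq_mem // mul1n mulnC.
- move=> /flattenP[l /nseqP[-> _]] /mapP[e' _ ->].
  by rewrite card_imset // card_ends.
- rewrite count_flatten_nseq count_map count_enum.
  under eq_finset => e do rewrite /= mem_j.
  case: (x.2 == o) => /=; last first.
    rewrite mul0n muln0 (_ : [set _ | _] = set0) ?cards0 ?muln0 //.
    by apply/setP=> e; rewrite !inE andbF.
  rewrite mul1n mulnC; case: (b) restC => [->//|->].
  by rewrite (_ : [set _ in _ | _] = set0) ?cards0 //; apply/setP=> e; rewrite !inE.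
rewrite count_flatten_nseq.
under eq_bigr do rewrite closed_walk_nseq count_flatten_nseq closed_walk_map.
rewrite -big_distrr -mulnDr /=.
(* A pair with a vertex of weight zero lies on no trail and in no factor edge, so both sides
   vanish. *)
have [/andP[/eqP xo /eqP yo]|noto] := boolP ((x.2 == o) && (y.2 == o)); last first.
  have notin (l : seq {set vertex G}) :
      count_mem [set x; y] [seq j @: (e : {set vertex G}) | e <- l] = 0.
    apply/count_memPn/mapP => -[A _ /setP eqA]; move: noto.
    have := eqA x; have := eqA y; rewrite !mem_j !inE !eqxx orbT /=.
    by move=> /esym/andP[-> _] /esym/andP[-> _].
  rewrite (map_comp (fun A : {set vertex G} => j @: A)) notin big1 => [|i _]; last exact: notin.
  by move: noto; rewrite negb_and => /orP[]/negPf->; rewrite !(mul0n, muln0).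
have count_j (l : seq {set vertex G}) :
    count_mem [set x; y] [seq j @: (e : {set vertex G}) | e <- l] = count_mem [set x.1; y.1] l.
  have [jx jy] : j x.1 = x /\ j y.1 = y.
    by rewrite /j -{1}xo -yo -!surjective_pairing.
  rewrite count_map; apply: eq_count => A /=.
  by rewrite -(inj_eq (imset_inj j_inj)) imsetU1 imset_set1 jx jy.
under eq_bigr do rewrite count_j -endsC count_map.
rewrite (map_comp (fun A : {set vertex G} => j @: A)) count_j count_map count_enum.
under eq_bigr => i _.
  rewrite (_ : count _ _ = #|[set e in C i | ends e == [set x.1; y.1]]|); last first.
    by rewrite count_uniq ?uniqe // defC.
  over.
by rewrite sum_blocks // pairG xo yo eqxx !mul1n mulnCA (mulnCA m) [RHS]mulnCA.
Qed.

End Cycles.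

Lemma map_nth_ord (T : Type) (x0 : T) (s : seq T) :
  [seq nth x0 s i | i : 'I_(size s) <- enum 'I_(size s)] = s.
Proof. by rewrite -[RHS](mkseq_nth x0) /mkseq -val_enum_ord -map_comp. Qed.

Lemma card_nth (T : Type) (x0 : T) (s : seq T) (a : pred T) :
  #|[set i : 'I_(size s) | a (nth x0 s i)]| = count a s.
Proof. by rewrite -sum1dep_card -[in RHS](map_nth_ord x0 s) -sum1_count big_map big_enum_cond. Qed.

Lemma sum_option (T : finType) (f : option T -> nat) :
  \sum_o f o = f None + \sum_i f (Some i).
Proof.
rewrite (bigD1 None) //=; congr (_ + _).
rewrite (reindex_omap Some id) /=; last by case.
by apply: eq_bigl => i; rewrite eqxx.
Qed.

(** At weight one a trail repeats no vertex, hence is a cycle. Moreover [pair_count] says that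
    trails and factor use each pair exactly as often as [H] has edges on it, so these uses can be
    labelled bijectively by the edges. *)
Lemma realize (H : multigraph) k (V : finType) (pi : vertex H -> V)
    (U : 'I_k -> {set V}) lam (T : 'I_k -> seq (vertex H)) F :
    detached pi U lam [forall x : vertex H, odd (degree x)] (fun=> 1) T F ->
    (forall x y : vertex H, #|[set e : edge H | ends e == [set x; y]]| = lam * (pi x != pi y)) ->
    (forall i, 1 < size (T i)) ->
  exists C : 'I_k -> {set edge H}, cycle_decomposition C /\
    forall i, vertices (C i) = [set x | pi x \in U i].
Proof.
set b := [forall x, _] => D pairH sizeT.
(* The index [None] stands for the 1-factor. An element of [P] is a place: an index together with a
   position in its list of pairs. *)
pose W (o : option 'I_k) := if o is Some i then closed_walk (T i) else F.
pose P : finType := {o : option 'I_k & 'I_(size (W o))}.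
pose h (p : P) : {set vertex H} := nth set0 (W (tag p)) (tagged p).
have card_h (A : {set vertex H}) : #|[set p | h p == A]| = \sum_o count_mem A (W o).
  under [RHS]eq_bigr do rewrite -(card_nth set0) -sum1dep_card.
  rewrite (@sig_big_dep _ _ _ _ (fun o => 'I_(size (W o))) predT
    (fun o t => nth set0 (W o) t == A) (fun _ _ => 1)) /=.
  by rewrite sum1dep_card.
have W2 o A : A \in W o -> exists x y, A = [set x; y].
  case: o => [i|] /=; first by case: (T i) => //= x s; exact: walk_pair.
  by move/(factor_card D)/eqP/cards2P => [x [y [_ ->]]]; exists x, y.
have [g g_bij gh] : exists2 g : P -> edge H, bijective g & forall p, ends (g p) = h p.
  apply: fiber_bij => A; rewrite card_h.
  have [/existsP[x /existsP[y /eqP->]]|none] := boolP [exists x, exists y, A == [set x; y]].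
    rewrite pairH sum_option /= addnC.
    by have := pair_count D x y; rewrite !muln1 => <-.
  rewrite big1 => [|o _]; last first.
    apply/count_memPn; apply: contraNN none => /W2[x [y ->]].
    by apply/existsP; exists x; apply/existsP; exists y.
  apply/esym/eqP; rewrite cards_eq0 -subset0; apply/subsetP => e.
  rewrite inE => /eqP eA; case/negP: none; have /eqP/cards2P := card_ends e.
  by move=> [x [y [_ exy]]]; apply/existsP; exists x; apply/existsP; exists y; rewrite -eA exy.
have [g' gK g'K] := g_bij.
pose mk o (t : 'I_(size (W o))) : P := Tagged (fun o => 'I_(size (W o))) t.
pose es o := [seq g (mk o t) | t <- enum 'I_(size (W o))].
have mem_es o e : (e \in es o) = (tag (g' e) == o).
  apply/mapP/eqP => [[t _ ->]|<-]; first by rewrite gK.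
  exists (tagged (g' e)); rewrite ?mem_enum // -[LHS]g'K; congr g.
  by rewrite /mk; case: (g' e).
have ends_es o : [seq ends e | e <- es o] = W o.
  rewrite -map_comp -[RHS](map_nth_ord set0); apply: eq_map => t /=.
  by rewrite gh.
have uniq_es o : uniq (es o).
  rewrite map_inj_uniq ?enum_uniq // => t t' /(can_inj gK) /eqP.
  by rewrite -tag_eqE /tag_eq /= eqxx tagged_asE => /eqP.
exists (fun i => [set e in es (Some i)]); split; last first.
  move=> i; rewrite (vertices_walk (ends_es (Some i))); apply/setP=> x; rewrite !inE.
  by rewrite -has_pred1 has_count (trail_count D) muln1 lt0b.
have restE : ~: (\bigcup_i [set e in es (Some i)]) = [set e in es None].
  apply/setP=> e; rewrite !inE mem_es; case: bigcupP => [[i _]|none].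
    by rewrite inE mem_es => /eqP->.
  case Ee: (tag _) => [i|] //; case: none; exists i => //.
  by rewrite inE mem_es Ee.
split=> [i|i i' ii'|]; last 1 first.
- rewrite restE -/b; case: (b) (factor_count D) => Fc.
    move=> x; rewrite -[RHS](Fc x) -[F]/(W None) -(ends_es None) count_map.
    by rewrite count_uniq.
  (* With [b] false no vertex lies in a member of [F], yet every member has two elements; so [F] is
     empty. *)
  suff -> : es None = [::] by apply/setP=> e; rewrite !inE.
  apply: size0nil; rewrite -(size_map (@ends H)) ends_es /=.
  case: (F) (factor_card D) Fc => //= A F' F2; have : A != set0.
    by rewrite -card_gt0 F2 ?mem_head.
  by case/set0Pn => x xA /(_ x); rewrite xA.
- apply/is_cycle_walk; exists (T i), (es (Some i)); split=> //.
  apply: count_mem_uniq => x; rewrite (trail_count D) muln1.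
  by rewrite -has_pred1 has_count (trail_count D) muln1 lt0b.
- apply/pred0P=> e; rewrite /= !inE !mem_es; apply/andP => -[/eqP-> /eqP[]].
  by apply/eqP.
Qed.

Theorem theorem3p2 (lambda m n : nat)
    (lambda_gt0 : 0 < lambda) (m_gt0 : 0 < m) (n_gt0 : 0 < n)
    (k : nat) (C : 'I_k -> {set edge (complete_multigraph (lambda * m) n)})
    (decC : cycle_decomposition C) :
  exists C' : 'I_k -> {set edge (complete_multipartite lambda n m)},
    cycle_decomposition C' /\
    forall i : 'I_k,
      vertices (C' i) = \bigcup_(j in vertices (C i)) part lambda m j.
Proof.
set G := complete_multigraph _ _ in C decC *.
set H := complete_multipartite _ _ _.
pose o := Ordinal m_gt0.
have symG : symmetric (fun x y : 'I_n => x != y) by move=> x y; rewrite eq_sym.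
have irrG : irreflexive (fun x y : 'I_n => x != y) by move=> x; rewrite eqxx.
have symH : symmetric (fun x y : 'I_n * 'I_m => x.1 != y.1) by move=> x y; rewrite eq_sym.
have irrH : irreflexive (fun x y : 'I_n * 'I_m => x.1 != y.1) by move=> x; rewrite eqxx.
have pairG (u v : vertex G) : #|[set e : edge G | ends e == [set u; v]]| = (u != v) * (lambda * m).
  by rewrite card_fold_ends adjacent_pair_set2.
have pairH (x y : vertex H) : #|[set e : edge H | ends e == [set x; y]]| = lambda * (x.1 != y.1).
  by rewrite card_fold_ends adjacent_pair_set2 // mulnC.
(* A vertex of [H] has the same degree as its part has in [G], so a 1-factor is present in both
   decompositions or in neither. *)
have odd_degree : [forall x : vertex G, odd (degree x)] = [forall x : vertex H, odd (degree x)].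
  have deg (x : vertex H) : degree x = degree (x.1 : vertex G).
    have sum_fst : \sum_(y : 'I_n * 'I_m) (x.1 != y.1) = (\sum_(v < n) (x.1 != v)) * m.
      rewrite -(pair_bigA _ (fun v (a : 'I_m) => (x.1 != v) : nat)) /= big_distrl /=.
      by apply: eq_bigr => v _; rewrite sum_nat_const card_ord mulnC.
    by rewrite !degree_fold // sum_fst mulnAC mulnA.
  apply/forallP/forallP => [oddG x|oddH v]; first by rewrite deg.
  by have := oddH (v, o); rewrite deg.
have [T0 [F0 D0]] := detached_blowup o decC pairG.
have [|T [F D]] := detach_all D0.
  move=> v; have sum_part (f : 'I_m -> nat) :
      \sum_(x : 'I_n * 'I_m | x.1 == v) f x.2 = \sum_a f a.
    rewrite -[RHS](big_pred1_eq addn v (fun=> \sum_a f a)) pair_big /=.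
    by apply: eq_bigl => x; rewrite andbT.
  rewrite (sum_part (fun a => (a == o) * m)) (sum_part (fun=> 1)) -big_distrl /=.
  under eq_bigr do rewrite eq_sym.
  by rewrite sum_indicator sum_nat_const card_ord mul1n muln1.
rewrite odd_degree in D.
have [|C' [decC' vC']] := realize (H := H) D pairH.
  (* The detached trail still visits [(v, o)] for each vertex [v] of the given cycle, so it is at
     least as long. *)
  move=> i; have [/(_ i) /is_cycle_walk[vs [es [sz uniqv _ E Ci]]] _ _] := decC.
  apply: leq_trans sz _; rewrite -(size_map (fun v => (v, o))).
  apply: uniq_leq_size => [|_ /mapP[v vvs ->]].
    by rewrite map_inj_uniq // => u v [].
  by rewrite -has_pred1 has_count (trail_count D) /= Ci (vertices_walk E) inE vvs.
exists C'; split=> // i; rewrite vC'; apply/setP=> x; rewrite inE.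
apply/idP/bigcupP => [xU|[v vU]]; first by exists x.1; rewrite ?inE.
by rewrite inE => /eqP->.
Qed.
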